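(* The set of weighted adjacency matrices $\mathbf{A}\in\mathbb{R}^{n\times n}$ which have nonnegative entries and an eigenvector orthogonal to $\mathbf{1}_n$ is a set of measure zero.
   Context: $n$ is the number of vertices of the graphs considered, and $\mathbf{1}_n\in\mathbb{R}^n$ is the vector of all ones. A weighted adjacency matrix (of an undirected weighted graph on $n$ vertices) is a real symmetric $n\times n$ matrix with zero diagonal and nonnegative off-diagonal entries, the $(i,j)$ entry being the weight characterizing the interaction between vertices $i$ and $j$ (zero if there is no edge). Such matrices are identified with points of $[0,\infty)^{n(n-1)/2}$ through their entries above the diagonal, and ''measure zero'' refers to Lebesgue measure on $\mathbb{R}^{n(n-1)/2}$. Eigenvectors are real and nonzero.
   Formalization: The case n = 2 is excluded: there every matrix [[0,a],[a,0]] has the eigenvector (1,-1), orthogonal to the all-ones vector, so the set is all of [0,∞) and does not have measure zero. *)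

(* Defs.v *)
From HB Require Import structures.
From mathcomp Require Import all_boot all_order all_algebra.
From mathcomp Require Import all_classical all_reals all_analysis.

Set Implicit Arguments.
Unset Strict Implicit.
Unset Printing Implicit Defensive.

Import Order.TTheory GRing.Theory Num.Theory.
Local Open Scope classical_set_scope.
Local Open Scope ring_scope.

Section sigma_finite_bundle.
Context disp (T : measurableType disp) (R : realType).
Variable m : {measure set T -> \bar R}.
Hypothesis m_fin : sigma_finite setT m.

Let m' : set T -> \bar R := m.

HB.instance Definition _ := Measure.on m'.

HB.instance Definition _ := Measure_isSigmaFinite.Build _ _ _ m' m_fin.

Lemma sigma_finite_bundle :
  exists m1 : {sigma_finite_measure set T -> \bar R},
    (m1 : set T -> \bar R) = m.
Proof. by exists m'. Qed.

End sigma_finite_bundle.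

Section lebesgue_tuple.
Local Open Scope ereal_scope.
Context {R : realType}.
Local Notation mR := (measurableTypeR R).

Definition tuple_cons d (p : mR * d.-tuple mR) : d.+1.-tuple mR :=
  [tuple of p.1 :: p.2].

Lemma measurable_tuple_cons d : measurable_fun setT (@tuple_cons d).
Proof. exact: measurable_cons. Qed.

(* Lebesgue measure on R^d, as the d-fold product of the one-dimensional
   [lebesgue_measure]; [lebesgue_tuple_box] gives its values on boxes. *)
Fixpoint lebesgue_tuple (d : nat) : set (d.-tuple mR) -> \bar R :=
  if d is d'.+1 then
    pushforward (lebesgue_measure \x @lebesgue_tuple d') (@tuple_cons d')
  else \d_[tuple].

Let uncons d (t : d.+1.-tuple mR) : mR * d.-tuple mR :=
  (thead t, [tuple of behead t]).

Let tuple_consK d : cancel (@tuple_cons d) (@uncons d).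
Proof.
by move=> [x t]; rewrite /uncons /tuple_cons theadE; congr pair; exact: val_inj.
Qed.

Let measurable_uncons d : measurable_fun setT (@uncons d).
Proof.
apply/measurable_fun_pairP; split; first exact: measurable_tnth.
exact: measurable_behead.
Qed.

Let bundled d :
  exists m : {sigma_finite_measure set (d.-tuple mR) -> \bar R},
    (m : set _ -> \bar R) = @lebesgue_tuple d.
Proof.
elim: d => [|d [m IH]]; first by exists (\d_([tuple] : 0.-tuple mR)).
rewrite /= -IH.
pose mu : {measure set (mR * d.-tuple mR)%type -> \bar R} :=
  (@lebesgue_measure R \x m).
set nu := pushforward _ _.
have nuE : nu = pushforward mu (@tuple_cons d) by [].
pose nuM : {measure set (d.+1.-tuple mR) -> \bar R} :=
  pushforward mu (@tuple_cons d).
have nu_fin : sigma_finite setT nu.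
  have [F FT mF] : sigma_finite setT mu.
    have /sigma_finiteP[F [FT ndF mF]] := sigma_finiteT (@lebesgue_measure R).
    have /sigma_finiteP[G [GT ndG mG]] := sigma_finiteT m.
    exists (fun n => F n `*` G n).
      rewrite -setXTT FT GT; apply/seteqP; split=> -[x y].
        move=> [/= [n _ Fnx] [k _ Gky]]; exists (maxn n k) => //; split.
        - by move: x Fnx; exact/subsetPset/ndF/leq_maxl.
        - by move: y Gky; exact/subsetPset/ndG/leq_maxr.
      by move=> [n _ [? ?]]; split; exists n.
    move=> k; have [? ?] := mF k; have [? ?] := mG k.
    split; first exact: measurableX.
    by rewrite /mu /= product_measure1E// lte_mul_pinfty// ge0_fin_numE.
  exists (fun n => @uncons d @^-1` F n).
    by rewrite -preimage_bigcup -FT preimage_setT.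
  move=> n; have [mFn Fnoo] := mF n; split.
    by rewrite -[X in measurable X]setTI; exact: measurable_uncons.
  rewrite nuE /pushforward -comp_preimage.
  by rewrite (_ : _ \o _ = id) //; apply/funext => x /=; rewrite tuple_consK.
have [m' m'E] := sigma_finite_bundle (m := nuM (@measurable_tuple_cons d)) nu_fin.
by exists m'.
Qed.

Let lebesgue_tuple0 d : @lebesgue_tuple d set0 = 0.
Proof. by have [m <-] := bundled d; rewrite measure0. Qed.

Let lebesgue_tuple_ge0 d A : 0 <= @lebesgue_tuple d A.
Proof. by have [m <-] := bundled d; exact: measure_ge0. Qed.

Let lebesgue_tuple_sigma_additive d : semi_sigma_additive (@lebesgue_tuple d).
Proof. by have [m <-] := bundled d; exact: measure_semi_sigma_additive. Qed.

HB.instance Definition _ d := isMeasure.Build _ _ _ (@lebesgue_tuple d)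
  (@lebesgue_tuple0 d) (@lebesgue_tuple_ge0 d)
  (@lebesgue_tuple_sigma_additive d).

Let lebesgue_tuple_sigma_finite d : sigma_finite setT (@lebesgue_tuple d).
Proof. by have [m <-] := bundled d; exact: sigma_finiteT. Qed.

HB.instance Definition _ d := Measure_isSigmaFinite.Build _ _ _
  (@lebesgue_tuple d) (@lebesgue_tuple_sigma_finite d).

Lemma lebesgue_tuple_box d (B : 'I_d -> set mR) :
  (forall i, measurable (B i)) ->
  lebesgue_tuple [set t | forall i, B i (tnth t i)] =
  \prod_(i < d) lebesgue_measure (B i).
Proof.
elim: d B => [|d IH] B mB.
  by rewrite big_ord0 /= diracE mem_set// => -[].
rewrite big_ord_recl -IH//=.
have mbox : measurable
    [set t : d.-tuple mR | forall i, B (lift ord0 i) (tnth t i)].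
  rewrite (_ : mkset _ = \bigcap_(i in [set: 'I_d])
      ((fun t : d.-tuple mR => tnth t i) @^-1` B (lift ord0 i))).
    apply: fin_bigcap_measurable => // i _; rewrite -[X in measurable X]setTI.
    exact: measurable_tnth.
  by apply/seteqP; split=> t /= h i => [_|]; [exact: h|exact: (h i I)].
rewrite -product_measure1E//; congr (product_measure1 _ _ _).
apply/seteqP; split=> [[x t] /= h|[x t] /= [h0 h1] i].
  split; first exact: (h ord0).
  by move=> i; have := h (lift ord0 i); rewrite /tuple_cons /= tnthS.
by case: (unliftP ord0 i) => [j ->|->//]; rewrite /tuple_cons /= tnthS.
Qed.

End lebesgue_tuple.
Arguments lebesgue_tuple R d : clear implicits.

Definition weighted_adjacency (R : realType) n (A : 'M[R]_n) : Prop :=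
  [/\ A^T = A, forall i, A i i = 0 & forall i j, 0 <= A i j].

Definition eigenvector (R : realType) n (A : 'M[R]_n) (v : 'cV[R]_n) : Prop :=
  v != 0 /\ exists a : R, A *m v = a *: v.

Definition ones (R : realType) (n : nat) : 'cV[R]_n := const_mx 1.

Definition cv_orthogonal (R : realType) n (u v : 'cV[R]_n) : Prop :=
  u^T *m v = 0.

Definition upper_pairs n : pred ('I_n * 'I_n) :=
  fun p => (p.1 < p.2)%N.
Arguments upper_pairs n p : clear implicits.

Lemma card_upper_pairs n : #|upper_pairs n| = (n * n.-1)./2.
Proof.
rewrite -bin2 -bin2_sum big_mkord -sum1_card.
rewrite (eq_bigl (fun p : 'I_n * 'I_n => xpredT p.1 && (p.1 < p.2)%N)) //.
rewrite -(pair_big_dep xpredT (fun i j : 'I_n => i < j)%N (fun _ _ => 1%N)) /=.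
rewrite (exchange_big_dep xpredT)//=; apply: eq_bigr => j _.
rewrite -(big_ord_widen n (fun=> 1%N)); last exact: ltnW.
by rewrite sum_nat_const card_ord muln1.
Qed.

(* The coordinates of a matrix in R^(n(n-1)/2): its entries above the
   diagonal, listed along the enumeration of the pairs i < j. *)
Definition upper_entries (R : realType) n (A : 'M[R]_n) :
    #|upper_pairs n|.-tuple (measurableTypeR R) :=
  [tuple A (enum_val k).1 (enum_val k).2 | k < #|upper_pairs n|].

Definition measure_zero (R : realType) n (S : set 'M[R]_n) : Prop :=
  (lebesgue_tuple R #|upper_pairs n|).-negligible (@upper_entries R n @` S).

(* Main.v *)
(* If A v = a v with v orthogonal to 1, then 1^T A^k v = 0 for all k, so the
   determinant of the Krylov matrix with rows 1^T A^k, k < n, vanishes. This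
   determinant is a polynomial in the entries of A above the diagonal, and a
   function on R^d that is polynomial on every line and is not identically
   zero has a null zero set, by induction on d and Fubini. It remains to find
   one symmetric matrix with zero diagonal whose Krylov determinant is nonzero:
   for n = 3 a weighted path, and from n to n + 1 one adds a vertex joined to
   all the others by edges of large weight t. *)

Require Import Defs.
From mathcomp Require Import all_boot all_order all_algebra.
From mathcomp Require Import all_classical all_reals all_analysis.
From mathcomp Require Import measurable_realfun lra.

Set Implicit Arguments.
Unset Strict Implicit.
Unset Printing Implicit Defensive.

Import Order.TTheory GRing.Theory Num.Theory.
Local Open Scope classical_set_scope.
Local Open Scope ring_scope.

(** * Krylov matrices *)

(** [iter] covers n = 0 as well, whereas [A ^+ k] asks for size [n.+1]. A general commutative ring
    allows entries in [{poly R}]. *)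
Definition krylov_row (K : comNzRingType) n (A : 'M[K]_n) k : 'rV[K]_n :=
  iter k (mulmxr A) (const_mx 1).

Definition krylov (K : comNzRingType) n (A : 'M[K]_n) : 'M[K]_n :=
  \matrix_(k, j) krylov_row A k 0 j.

Lemma map_krylov (K L : comNzRingType) (f : {rmorphism K -> L}) n
    (A : 'M[K]_n) : map_mx f (krylov A) = krylov (map_mx f A).
Proof.
have mapr k : map_mx f (krylov_row A k) = krylov_row (map_mx f A) k.
  elim: k => [|k IH]; first by apply/matrixP=> i j; rewrite !mxE rmorph1.
  by rewrite /krylov_row !iterS /= map_mxM IH.
by apply/matrixP=> k j; rewrite !mxE -mapr !mxE.
Qed.

Lemma krylov_row_mul (K : comNzRingType) n (A : 'M[K]_n) k (u : 'cV[K]_n) :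
  krylov_row A k *m u = const_mx 1 *m iter k (mulmx A) u.
Proof.
elim: k u => [//|k IH] u.
by rewrite iterSr -IH /krylov_row iterS /= mulmxA.
Qed.

Lemma krylov_mul (K : comNzRingType) n (A : 'M[K]_n) (u : 'cV[K]_n) k :
  (krylov A *m u) k 0 = (krylov_row A k *m u) 0 0.
Proof. by rewrite !mxE; apply: eq_bigr => j _; rewrite mxE. Qed.

Lemma krylov_row_exp (K : comNzRingType) n (A : 'M[K]_n.+1) k :
  krylov_row A k = const_mx 1 *m A ^+ k.
Proof.
elim: k => [|k IH]; first by rewrite expr0 mulmx1.
by rewrite /krylov_row iterS -/(krylov_row A k) IH exprSr /= mulmxA.
Qed.

Lemma det_eq0_ker (F : fieldType) n (M : 'M[F]_n) :
  reflect (exists2 u : 'cV[F]_n, u != 0 & M *m u = 0) (\det M == 0).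
Proof.
rewrite -det_tr; apply: (iffP det0P) => -[u u0 Mu].
  by exists u^T; rewrite ?trmx_eq0// -[M]trmxK -trmx_mul Mu trmx0.
by exists u^T; rewrite ?trmx_eq0// -trmx_mul Mu trmx0.
Qed.

Lemma det_krylov_eigenvector (F : fieldType) n (A : 'M[F]_n) (v : 'cV[F]_n) a :
  v != 0 -> A *m v = a *: v -> const_mx 1 *m v = (0 : 'M[F]_1) ->
  \det (krylov A) = 0.
Proof.
move=> v0 Av ov; apply/eqP/det_eq0_ker; exists v => //.
apply/colP => k; rewrite krylov_mul krylov_row_mul [RHS]mxE.
suff -> : iter k (mulmx A) v = a ^+ k *: v by rewrite -scalemxAr ov scaler0 mxE.
elim: (k : nat) => [|m IH]; first by rewrite expr0 scale1r.
by rewrite iterS IH -scalemxAr Av scalerA exprSr.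
Qed.

(** * Observability of the pair (1^T, A) *)

(** The unobservable subspace of control theory. Taking all k, not only k < n, makes its stability
    under A immediate. *)
Definition unobservable (K : comNzRingType) n (A : 'M[K]_n) (u : 'cV[K]_n) :=
  forall k, \sum_i iter k (mulmx A) u i 0 = 0.

Definition observable (K : comNzRingType) n (A : 'M[K]_n) :=
  forall u, unobservable A u -> u = 0.

Lemma unobservableE (K : comNzRingType) n (A : 'M[K]_n) (u : 'cV[K]_n) :
  unobservable A u <-> forall k, krylov_row A k *m u = 0.
Proof.
have E k : (krylov_row A k *m u) 0 0 = \sum_i iter k (mulmx A) u i 0.
  rewrite krylov_row_mul mxE; apply: eq_bigr => i _; by rewrite mxE mul1r.
split=> h k; last by rewrite -E h mxE.
by apply/matrixP => i j; rewrite !ord1 E h mxE.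
Qed.

Lemma observable_det (F : fieldType) n (A : 'M[F]_n) :
  observable A -> \det (krylov A) != 0.
Proof.
case: n A => [|n] A obsA; first by rewrite det_mx00 oner_eq0.
apply/negP => /det_eq0_ker[u /eqP u0 Ku]; apply: u0; apply: obsA.
apply/unobservableE => k; rewrite krylov_row_exp.
(* Cayley-Hamilton: A ^+ k is a combination of the A ^+ i with i <= n *)
have -> : A ^+ k = horner_mx A ('X^k %% char_poly A).
  rewrite -[X in X ^+ k](horner_mx_X A) -rmorphXn {1}(divp_eq 'X^k (char_poly A)).
  by rewrite rmorphD rmorphM /= Cayley_Hamilton mulr0 add0r.
set p := _ %% _.
have sp : (size p <= n.+1)%N.
  by rewrite -ltnS -(size_char_poly A) ltn_modp monic_neq0 ?char_poly_monic.
rewrite -(coefK p) poly_def rmorph_sum /= mulmx_sumr mulmx_suml big1// => i _.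
rewrite linearZ /= rmorphXn /= horner_mx_X -scalemxAr -scalemxAl.
have ltin : (i < n.+1)%N by apply: leq_trans sp.
rewrite -krylov_row_exp; apply/eqP; rewrite scaler_eq0; apply/orP; right.
apply/eqP/matrixP => a b; rewrite !ord1.
by have /colP/(_ (Ordinal ltin)) := Ku; rewrite krylov_mul => ->; rewrite !mxE.
Qed.

Lemma unobservable_mul (K : comNzRingType) n (A : 'M[K]_n) u :
  unobservable A u -> unobservable A (A *m u).
Proof. by move=> h k; have := h k.+1; rewrite iterSr. Qed.

Lemma unobservableD (K : comNzRingType) n (A : 'M[K]_n) u v :
  unobservable A u -> unobservable A v -> unobservable A (u + v).
Proof.
move=> /unobservableE hu /unobservableE hv; apply/unobservableE => k.
by rewrite mulmxDr hu hv addr0.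
Qed.

Lemma unobservableZ (K : comNzRingType) n (A : 'M[K]_n) a u :
  unobservable A u -> unobservable A (a *: u).
Proof.
move=> /unobservableE hu; apply/unobservableE => k.
by rewrite -scalemxAr hu scaler0.
Qed.

(** * Cones over a graph, and observability for every n other than 2 *)

Definition cone (K : comNzRingType) n (t : K) (A : 'M[K]_n) : 'M[K]_(1 + n) :=
  block_mx 0 (const_mx t) (const_mx t) A.

Lemma tr_cone (K : comNzRingType) n (t : K) (A : 'M[K]_n) :
  (cone t A)^T = cone t A^T.
Proof. by rewrite /cone tr_block_mx trmx0 !trmx_const. Qed.

Lemma cone_diag (K : comNzRingType) n (t : K) (A : 'M[K]_n) :
  (forall i, A i i = 0) -> forall i, cone t A i i = 0.
Proof.
move=> A0 i; rewrite /cone; case: (split_ordP i) => j ->.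
  by rewrite block_mxEul mxE.
by rewrite block_mxEdr.
Qed.

Lemma cone_mul (K : comNzRingType) n (t : K) (A : 'M[K]_n) x (u : 'cV[K]_n) :
  cone t A *m col_mx x%:M u =
  col_mx (t * \sum_i u i 0)%:M (const_mx (t * x) + A *m u).
Proof.
rewrite mul_block_col mul0mx add0r; congr (col_mx _ (_ + _)).
  apply/matrixP=> i j; rewrite !ord1 !mxE mulr1n mulr_sumr.
  by apply: eq_bigr => k _; rewrite mxE.
by apply/matrixP=> i j; rewrite !ord1 !mxE big_ord1 !mxE mulr1n.
Qed.

Lemma sum_col_mx1 (K : comNzRingType) n x (u : 'cV[K]_n) :
  \sum_i col_mx x%:M u i 0 = x + \sum_i u i 0.
Proof.
rewrite big_split_ord big_ord1 /= col_mxEu mxE mulr1n; congr (_ + _).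
by apply: eq_bigr => i _; rewrite col_mxEd.
Qed.

(** If the entries of u sum to 0, the cone sends (0, u) to (0, A u). So all iterates keep apex
    coordinate 0, and their sums are those of the iterates of u under A. *)
Lemma cone_unobservable0 (K : comNzRingType) n (t : K) (A : 'M[K]_n) u :
  unobservable (cone t A) (col_mx 0%:M u) -> unobservable A u.
Proof.
move=> h k; elim: k u h => [|k IH] u h.
  by have := h 0%N; rewrite /= sum_col_mx1 add0r.
rewrite iterSr; apply: IH.
have su : \sum_i u i 0 = 0 by have := h 0%N; rewrite /= sum_col_mx1 add0r.
have := unobservable_mul h; rewrite cone_mul su mulr0.
by rewrite (_ : const_mx _ = 0) ?add0r//; apply/matrixP => i j; rewrite !mxE.
Qed.

(** For n > 1 the matrix I - J, with J all ones, is invertible, hence so is A + t (I - J) for large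
    t. Quantitatively, with s the sum of u, N its l1 norm and a the sum of the [|A i j|], adding up
    the equations gives (n - 1) t |s| <= a N, and bounding each separately gives t N <= n t |s| + a
    N. *)
Lemma shifted_solution_eq0 (R : realFieldType) n (A : 'M[R]_n) (u : 'cV[R]_n)
    (t : R) : (1 < n)%N -> 3 * (\sum_i \sum_j `|A i j|) < t ->
  (forall i, (A *m u) i 0 + t * u i 0 = t * \sum_j u j 0) -> u = 0.
Proof.
move=> n1; set a := \sum_i _ => at3 eqn; set s := \sum_j _ in eqn.
pose N := \sum_i `|u i 0|.
have a0 : 0 <= a by apply: sumr_ge0 => i _; exact: sumr_ge0.
have t0 : 0 < t by apply: le_lt_trans at3; rewrite mulr_ge0.
have N0 : 0 <= N by exact: sumr_ge0.
have uN i : `|u i 0| <= N by rewrite /N (bigD1 i)//= lerDl sumr_ge0.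
have AuN : \sum_i `|(A *m u) i 0| <= a * N.
  rewrite /a mulr_suml; apply: ler_sum => i _; rewrite mxE mulr_suml.
  apply: le_trans (ler_norm_sum _ _ _) _; apply: ler_sum => j _.
  by rewrite normrM ler_wpM2l.
have sumA : \sum_i (A *m u) i 0 = (n%:R - 1) * (t * s).
  have : \sum_i ((A *m u) i 0 + t * u i 0) = n%:R * (t * s).
    by rewrite (eq_bigr _ (fun i _ => eqn i)) sumr_const card_ord mulr_natl.
  rewrite big_split /= -mulr_sumr -/s => h; lra.
have n2 : 2 <= n%:R :> R by rewrite ler_nat.
have ts : (n%:R - 1) * (t * `|s|) <= a * N.
  apply: le_trans AuN; apply: le_trans (ler_norm_sum _ _ _).
  by rewrite sumA !normrM (gtr0_norm t0) ger0_norm //; lra.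
have tN : t * N <= n%:R * (t * `|s|) + a * N.
  rewrite /N mulr_sumr -/N.
  apply: (@le_trans _ _ (\sum_i (t * `|s| + `|(A *m u) i 0|))).
    apply: ler_sum => i _.
    have -> : t * `|u i 0| = `|t * s - (A *m u) i 0|.
      by rewrite -[t * s](eqn i) addrAC subrr add0r normrM (gtr0_norm t0).
    by apply: le_trans (ler_normB _ _) _; rewrite normrM (gtr0_norm t0).
  by rewrite big_split /= sumr_const card_ord mulr_natl lerD2l.
have s0 : 0 <= t * `|s| by rewrite mulr_ge0// ltW.
(* Since n <= 2 (n - 1), the two bounds give t N <= 3 a N; this is the origin of the constant 3. *)
have N00 : N = 0 by nra.
apply/colP => i; rewrite mxE; apply/eqP; rewrite -normr_le0.
by rewrite -N00.
Qed.

(** For unobservable w = (x, u), x is minus the sum of u, so [cone t A *m w + t *: w] has apex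
    coordinate 0. Its base part is then unobservable for A, hence 0, which is the system of
    [shifted_solution_eq0]. *)
Lemma cone_observable (R : realFieldType) n (A : 'M[R]_n) (t : R) :
  (1 < n)%N -> 3 * (\sum_i \sum_j `|A i j|) < t ->
  observable A -> observable (cone t A).
Proof.
move=> n1 at3 obsA w.
have wE : w = col_mx (w 0 0)%:M (dsubmx w).
  rewrite -[LHS]vsubmxK; congr col_mx.
  apply/matrixP=> i j; rewrite !ord1 !mxE mulr1n.
  by congr (w _ _); exact: val_inj.
rewrite wE; move: (w 0 0) (dsubmx w) => x u hw {w wE}.
have xE : x = - \sum_i u i 0.
  by have /eqP := hw 0%N; rewrite /= sum_col_mx1 addr_eq0 => /eqP.
have hTw := unobservable_mul hw.
(* The sum over the base is an eigenfunctional of the cone, for -t, on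
   unobservable vectors; hence it vanishes on cone t A *m w + t *: w. *)
have sT : \sum_i (const_mx (t * x) + A *m u) i 0 = - (t * \sum_i u i 0).
  by have /eqP := hTw 0%N; rewrite /= cone_mul sum_col_mx1 addrC addr_eq0 => /eqP.
have hz := unobservableD hTw (unobservableZ t hw).
move: hz; rewrite cone_mul scale_col_mx scale_scalar_mx add_col_mx -raddfD /=.
rewrite xE mulrN subrr => /cone_unobservable0/obsA/colP z0.
have u0 : u = 0.
  apply: (shifted_solution_eq0 n1 at3) => i.
  by have := z0 i; rewrite !mxE => h; lra.
by rewrite u0 big1 ?oppr0 ?raddf0 ?col_mx0// => i _; rewrite mxE.
Qed.

Lemma observable_path3 (F : realFieldType) :
  exists A : 'M[F]_3, [/\ A^T = A, forall i, A i i = 0 & observable A].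
Proof.
(* The path 0 - 1 - 2 with weights 1 and 2, read off from i + j. Equal weights would fail, because
   of the eigenvector (1, 0, -1). *)
pose c (i j : nat) : F := if (i + j == 1)%N then 1
  else if (i + j == 3)%N then 2 else 0.
exists (\matrix_(i, j) c i j); split.
- by apply/matrixP => i j; rewrite !mxE /c addnC.
- by move=> i; rewrite mxE /c addnn; case: i => -[|[|[]]].
move=> u h.
have := h 0%N; have := h 1%N; have := h 2%N.
rewrite /= !big_ord_recl !big_ord0 !mxE !big_ord_recl !big_ord0 !mxE.
rewrite !big_ord_recl !big_ord0 !mxE /c /=.
move=> h2 h1 h0; have [u0 u1 u2] :
    [/\ u ord0 0 = 0, u (lift ord0 ord0) 0 = 0
      & u (lift ord0 (lift ord0 ord0)) 0 = 0].
  by split; lra.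
apply/colP => i; rewrite mxE.
have [j ->|->//] := unliftP ord0 i; have [k ->|->//] := unliftP ord0 j.
by rewrite ord1.
Qed.

(** For n = 2 the vector (1, -1) is always an eigenvector, so the induction by cones starts at n =
    3. *)
Lemma exists_observable (R : realFieldType) n : n <> 2%N ->
  exists A : 'M[R]_n, [/\ A^T = A, forall i, A i i = 0 & observable A].
Proof.
move=> n2; case: n n2 => [|[|[//|n]]] _.
- exists 0; split; [exact: trmx0|by case|].
  by move=> u _; apply/matrixP => -[].
- exists 0; split; [exact: trmx0|by move=> i; rewrite mxE|].
  move=> u /(_ 0%N); rewrite big_ord1 /= => u0.
  by apply/colP => i; rewrite !ord1 u0 mxE.
elim: n => [|n [A [AT A0 obsA]]]; first exact: observable_path3.
exists (cone (3 * (\sum_i \sum_j `|A i j|) + 1) A); split.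
- by rewrite tr_cone AT.
- exact: cone_diag.
- by apply: cone_observable => //; rewrite ltrDl.
Qed.

(** * Null zero sets of functions polynomial on lines *)

Section PolyOnLines.
Variable R : realType.
Local Notation mR := (measurableTypeR R).

Definition line_point d (a b : d.-tuple mR) (x : R) : d.-tuple mR :=
  [tuple (tnth a i : R) + x * (tnth b i : R) | i < d].

(** A substitute for multivariate polynomials that passes to slices and gives a one-variable
    polynomial along the first axis. *)
Definition poly_on_lines d (f : d.-tuple mR -> R) :=
  forall a b, exists p : {poly R}, forall x, f (line_point a b x) = p.[x].

Lemma line_point_cons d (a b : d.-tuple mR) (a0 b0 x : R) :
  line_point (tuple_cons (a0 : mR, a)) (tuple_cons (b0 : mR, b)) x =
  tuple_cons (a0 + x * b0 : mR, line_point a b x).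
Proof.
apply: eq_from_tnth => i; rewrite tnth_mktuple.
by case: (unliftP ord0 i) => [j ->|->//]; rewrite !tnthS /= tnth_mktuple.
Qed.

Lemma line_point0 d (a : d.-tuple mR) x :
  line_point a (nseq_tuple d (0 : mR)) x = a.
Proof.
apply: eq_from_tnth => i; rewrite tnth_mktuple.
by rewrite (tnth_nth 0 (nseq_tuple _ _)) /= nth_nseq ltn_ord mulr0 addr0.
Qed.

Lemma finite_roots (p : {poly R}) : p != 0 -> finite_set [set x | p.[x] = 0].
Proof.
elim: (size p) {-2}p (leqnn (size p)) => {p} [|n IH] p.
  by rewrite leqn0 size_poly_eq0 => ->.
have [[x /eqP px]|noroot] := pselect (exists x, p.[x] = 0); last first.
  by move=> _ _; rewrite (_ : mkset _ = set0)// -subset0 => x px;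
    apply: noroot; exists x.
have /factor_theorem[q pE] : root p x by [].
rewrite {px}pE => sz; rewrite mulf_eq0 negb_or => /andP[q0 _].
move: sz; rewrite size_Mmonic ?monicXsubC// size_XsubC addn2 ltnS => sz.
apply: (@sub_finite_set _ _ ([set x] `|` [set y | q.[y] = 0])).
  move=> y /= /eqP; rewrite hornerM mulf_eq0 hornerXsubC subr_eq0.
  by move=> /orP[/eqP ?|/eqP ?]; [right|left].
by rewrite finite_setU; split; [exact: finite_set1|exact: IH].
Qed.

(** Write w = (w0, wt). The polynomial x |-> f (x, wt) is nonzero at w0, so it has finitely many
    roots. For any other x the slice f (x, _) is nonzero at wt, hence has a null zero set by
    induction. *)
Lemma poly_on_lines_null d (f : d.-tuple mR -> R) w :
  measurable_fun setT (f : _ -> mR) -> poly_on_lines f -> f w != 0 ->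
  lebesgue_tuple R d (f @^-1` [set 0]) = 0%E.
Proof.
elim: d f w => [|d IH] f w mf pf fw.
  rewrite /= diracE memNset// => /= f0; move: fw.
  by rewrite (tuple0 w) f0 eqxx.
pose g (x : mR) t := f (tuple_cons (x, t)).
have mcons x : measurable_fun setT (fun t : d.-tuple mR => tuple_cons (x : mR, t)).
  exact: (measurable_cons (measurable_cst x) (@measurable_id _ _ setT)).
have gIH x t : g x t != 0 -> lebesgue_tuple R d (g x @^-1` [set 0]) = 0%E.
  move=> gxt; apply: (IH _ t) => //; first exact: (measurableT_comp mf (mcons x)).
  (* A line in the slice is a line whose direction has first coordinate 0. *)
  move=> a b; have [p pE] := pf (tuple_cons (x, a)) (tuple_cons (0 : mR, b)).
  by exists p => y; rewrite -pE line_point_cons mulr0 addr0.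
pose w0 := thead w; pose wt := [tuple of behead w].
have wE : w = tuple_cons (w0, wt) by exact: tuple_eta.
have [p pE] := pf (tuple_cons (0 : mR, wt)) (tuple_cons (1 : mR, nseq_tuple d (0 : mR))).
have {}pE x : g x wt = p.[x].
  by rewrite -pE line_point_cons line_point0 mulr1 add0r.
have p0 : p != 0.
  apply: contraNneq fw => p0; rewrite wE -[f _]/(g w0 wt) pE p0 horner0 //.
pose Z := f @^-1` [set 0].
have mZ : measurable (@tuple_cons R d @^-1` Z).
  rewrite -[X in measurable X]setTI; apply: measurable_tuple_cons => //.
  by rewrite -[X in measurable X]setTI; exact: mf.
have finN := finite_roots p0.
rewrite /= /pushforward /product_measure1 /=.
(* The finitely many roots of p are discarded from the integral of slice measures; elsewhere the
   integrand is 0. *)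
rewrite (@ge0_negligible_integral _ mR _ _ setT ([set x | p.[x] = 0] : set mR))//.
- apply: integral0_eq => x [_ /= px]; rewrite xsectionE.
  by apply: (gIH x wt); rewrite pE; exact/eqP.
- by apply: countable_measurable; [exact: measurable_set1|exact: finite_set_countable].
- exact: (measurable_fun_xsection (lebesgue_tuple R d) mZ).
- by apply: countable_lebesgue_measure0; exact: finite_set_countable.
Qed.
End PolyOnLines.

(** * Symmetric matrices from their coordinates above the diagonal *)

Section UpperEntries.
Variables (R : realType) (n : nat).
Local Notation mR := (measurableTypeR R).
Local Notation d := #|upper_pairs n|.

(* Zero unless i < j: pairs that are not enumerated have an index past the
   end of the tuple, where nth returns its default. *)
Definition upper_coord (t : d.-tuple mR) (i j : 'I_n) : R :=
  nth (0 : mR) t (index (i, j) (enum (upper_pairs n))).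

(** At most one summand is nonzero, and the entries stay linear in t. *)
Definition symmetric_of (t : d.-tuple mR) : 'M[R]_n :=
  \matrix_(i, j) (upper_coord t i j + upper_coord t j i).

Lemma upper_coord_entries (A : 'M[R]_n) i j :
  upper_coord (upper_entries A) i j = if (i < j)%N then A i j else 0.
Proof.
rewrite /upper_coord; have [ij|ij] := boolP (i < j)%N.
  have ijU : (i, j) \in upper_pairs n by [].
  have kd : (index (i, j) (enum (upper_pairs n)) < d)%N.
    by rewrite cardE index_mem mem_enum.
  rewrite -[index _ _]/(nat_of_ord (Ordinal kd)) -tnth_nth tnth_mktuple.
  have -> : enum_val (Ordinal kd) = (i, j).
    by rewrite (enum_val_nth (i, j)) nth_index// mem_enum.
  by [].
rewrite nth_default// size_tuple cardE leqNgt index_mem mem_enum.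
exact: ij.
Qed.

Lemma upper_entriesK (A : 'M[R]_n) : A^T = A -> (forall i, A i i = 0) ->
  symmetric_of (upper_entries A) = A.
Proof.
move=> AT A0; apply/matrixP => i j; rewrite mxE !upper_coord_entries.
case: ltngtP => [_|_|/val_inj ->]; rewrite ?addr0 ?add0r ?A0//.
by rewrite -[in RHS]AT mxE.
Qed.

Lemma upper_coord_line a b i j x :
  upper_coord (line_point a b x) i j = upper_coord a i j + x * upper_coord b i j.
Proof.
rewrite /upper_coord; set k := index _ _.
have [kd|kd] := ltnP k d; last by rewrite !nth_default ?size_tuple// mulr0 addr0.
by rewrite -[k]/(nat_of_ord (Ordinal kd)) -!tnth_nth tnth_mktuple.
Qed.

Lemma symmetric_of_line a b x :
  symmetric_of (line_point a b x) = symmetric_of a + x *: symmetric_of b.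
Proof.
by apply/matrixP => i j; rewrite !mxE !upper_coord_line mulrDr addrACA.
Qed.

Lemma krylov_poly_on_lines :
  poly_on_lines (fun t => \det (krylov (symmetric_of t))).
Proof.
(* On the line the matrix is M, with entries in R[X], evaluated at x; evaluation is a ring morphism,
   so it commutes with [krylov] and [\det]. *)
move=> a b; pose M := map_mx polyC (symmetric_of a) + 'X *: map_mx polyC (symmetric_of b).
exists (\det (krylov M)) => x.
rewrite -[RHS]/(horner_eval x _) -det_map_mx map_krylov; congr (\det (krylov _)).
rewrite symmetric_of_line; apply/matrixP => i j.
by rewrite /M !mxE -[RHS]/(horner _ x) hornerD hornerM hornerX !hornerC.
Qed.

Lemma measurable_upper_coord i j :
  measurable_fun setT (fun t => upper_coord t i j : mR).
Proof.
rewrite /upper_coord; set k := index _ _.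
have [kd|kd] := ltnP k d.
  rewrite (_ : (fun t => _) = (fun t => tnth t (Ordinal kd))).
    exact: measurable_tnth.
  by apply/funext => t; rewrite (tnth_nth (0 : mR)).
rewrite (_ : (fun t => _) = cst (0 : mR)); first exact: measurable_cst.
by apply/funext => t; rewrite nth_default ?size_tuple.
Qed.
End UpperEntries.

(** * Measurability and conclusion *)

Lemma measurable_det_krylov disp (T : measurableType disp) (R : realType) n
    (M : T -> 'M[R]_n) :
  (forall i j, measurable_fun setT (fun t => M t i j)) ->
  measurable_fun setT (fun t => \det (krylov (M t))).
Proof.
move=> mM.
have mrow k j : measurable_fun setT (fun t => krylov_row (M t) k 0 j).
  elim: k j => [|k IH] j.
    by under eq_fun do rewrite mxE; exact: (@measurable_cst _ _ _ R).
  under eq_fun do rewrite mxE.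
  by apply: measurable_sum => i; exact: measurable_funM.
(* [\det] unfolds to the Leibniz sum over permutations s. *)
apply: measurable_sum => s; apply: measurable_funM.
  exact: (@measurable_cst _ _ _ R).
apply: (@measurable_prod _ _ _ _ 'I_n _ (fun i t => krylov (M t) i _)) => i _.
under eq_fun do rewrite mxE.
exact: mrow.
Qed.

Theorem theorem1 (R : realType) (n : nat) (hn : n <> 2%N) :
  measure_zero [set A : 'M[R]_n | weighted_adjacency A /\
    exists v : 'cV[R]_n, eigenvector A v /\ cv_orthogonal (ones R n) v].
Proof.
pose f (t : _.-tuple (measurableTypeR R)) := \det (krylov (@symmetric_of R n t)).
have mf : measurable_fun setT (f : _ -> measurableTypeR R).
  apply: measurable_det_krylov => i j.
  under eq_fun do rewrite mxE.
  by apply: measurable_funD; exact: measurable_upper_coord.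
(* Negligibility asks for a measurable null superset: the zero set of the Krylov determinant on the
   whole coordinate space. *)
exists (f @^-1` [set 0]); split.
- by rewrite -[X in measurable X]setTI; exact: mf.
- have [A [AT A0 obsA]] := exists_observable R hn.
  apply: (@poly_on_lines_null _ _ _ (upper_entries A)) => //.
    exact: krylov_poly_on_lines.
  by rewrite /f upper_entriesK// observable_det.
move=> _ [A [[AT A0 _] [v [[v0 [a Av]] ov]]] <-] /=.
rewrite /f upper_entriesK//; apply: det_krylov_eigenvector v0 Av _.
by rewrite -ov /ones trmx_const.
Qed.
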